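(* Let $\Omega_X\subset\mathbb{R}$ be a bounded open interval, and let $f_0:\overline{\Omega_X}\to\mathbb{R}$ and $F:\mathbb{R}\to\mathbb{R}$ be given (sufficiently smooth). Let $x=x(X,t)$ be a (sufficiently smooth) solution, with $\frac{\partial x}{\partial X}>0$, of the system $$x_t(X,t)\,f_0'(X)\Big(\frac{\partial x}{\partial X}\Big)^{-1}=-\partial_X\Big(f_0'(X)\Big(\frac{\partial x}{\partial X}\Big)^{-1}\Big)\Big(\frac{\partial x}{\partial X}\Big)^{-1}+F'(f_0(X)),\qquad X\in\Omega_X,\ t>0,$$ $$x(X,t)=X\ \text{ for } X\in\partial\Omega_X,\qquad x(X,0)=X\ \text{ for } X\in\Omega_X.$$ Then $x$ satisfies the energy dissipative law $$\frac{d}{dt}\int_{\Omega_X}\frac{\partial x}{\partial X}\Big\{\frac12\Big|f_0'(X)\Big(\frac{\partial x}{\partial X}\Big)^{-1}\Big|^2+F(f_0(X))\Big\}\,dX=-\int_{\Omega_X}\frac{\partial x}{\partial X}\Big|x_t(X,t)f_0'(X)\Big(\frac{\partial x}{\partial X}\Big)^{-1}\Big|^2dX .$$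
   Context: The system is the one-dimensional trajectory equation (Lagrangian form) of the Allen–Cahn equation $f_t-\Delta f+F'(f)=0$ with initial datum $f_0$ and nonlinear potential $F$ (for example $F(f)=\frac{1}{4\epsilon^2}(f^2-1)^2$). $X$ is the Lagrangian coordinate, $x(X,t)$ is the flow map, $x_t=\partial x/\partial t$ at fixed $X$, and $\left(\frac{\partial x}{\partial X}\right)^{-1}$ denotes the reciprocal $1/\frac{\partial x}{\partial X}$. *)

(* Defs.v *)
From Stdlib Require Import Reals.
From Coquelicot Require Import Coquelicot.
Open Scope R_scope.

(* Derivative relative to a set D: the difference quotient is restricted to D,
   so on a closed interval it is one-sided at the endpoints, and the values of
   f outside D play no role. *)
Definition is_derive_on (D : R -> Prop) (f : R -> R) (x l : R) : Prop :=
  filterlim (fun y => (f y - f x) / (y - x)) (within D (locally' x)) (locally l).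

Definition ex_derive_on (D : R -> Prop) (f : R -> R) (x : R) : Prop :=
  exists l : R, is_derive_on D f x l.

(* The unspecified value of [iota] is used only where no derivative exists. *)
Definition Derive_on (D : R -> Prop) (f : R -> R) (x : R) : R :=
  iota (is_derive_on D f x).

Definition C1_on (D : R -> Prop) (f : R -> R) : Prop :=
  (forall x, D x -> ex_derive_on D f x) /\ continuous_on D (Derive_on D f).

Definition C2_on (D : R -> Prop) (f : R -> R) : Prop :=
  C1_on D f /\ C1_on D (Derive_on D f).

Definition C1_R (f : R -> R) : Prop :=
  (forall y, ex_derive f y) /\ (forall y, continuous (Derive f) y).

Definition Icc (a b : R) : R -> Prop := fun X => a <= X <= b.

(* For u = u(X,t) on [a,b] x (0,oo). *)
Definition dX (a b : R) (u : R -> R -> R) (X t : R) : R :=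
  Derive_on (Icc a b) (fun Y => u Y t) X.

Definition dt (u : R -> R -> R) (X t : R) : R :=
  Derive (fun s => u X s) t.

Definition jointly_continuous_on (Q : R * R -> Prop) (u : R -> R -> R) : Prop :=
  continuous_on Q (fun p : R * R => u (fst p) (snd p)).

Definition cyl (a b : R) : R * R -> Prop :=
  fun p => a <= fst p <= b /\ 0 < snd p.

Definition cyl0 (a b : R) : R * R -> Prop :=
  fun p => a <= fst p <= b /\ 0 <= snd p.

Definition C1_cyl (a b : R) (u : R -> R -> R) : Prop :=
  (forall X t, a <= X <= b -> 0 < t ->
     ex_derive_on (Icc a b) (fun Y => u Y t) X /\ ex_derive (fun s => u X s) t) /\
  jointly_continuous_on (cyl a b) (dX a b u) /\
  jointly_continuous_on (cyl a b) (dt u).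

Definition C2_cyl (a b : R) (u : R -> R -> R) : Prop :=
  C1_cyl a b u /\ C1_cyl a b (dX a b u) /\ C1_cyl a b (dt u).

(* Main.v *)
(* Write p = dx/dX, v = x_t and h = - (1/2) (f0'/p)^2 + F(f0).  Since p_t = v_X,
   differentiating under the integral sign turns the left-hand side into the
   integral of v_X h.  Multiplying the equation by f0' shows that
   h_X = v f0'^2 / p, and v vanishes at both endpoints because x is constant in
   time there, so integrating by parts gives minus the integral of
   v^2 f0'^2 / p = p |v f0' / p|^2. *)
Require Import Defs.
From Stdlib Require Import Reals Lra.
From Coquelicot Require Import Coquelicot.
Open Scope R_scope.

(** * Continuous extension from the closed interval to the line *)

(* Precomposing with [clamp a b] extends a function on [a, b] continuously to
   R, so that the two-sided integration and differentiation lemmas of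
   Coquelicot apply to functions that are only controlled on [a, b]. *)
Definition clamp (a b X : R) : R := Rmax a (Rmin b X).

Lemma clamp_Icc (a b X : R) : a <= b -> a <= clamp a b X <= b.
Proof.
  intros hab; unfold clamp; split.
  - apply Rmax_l.
  - apply Rmax_lub; [exact hab | apply Rmin_l].
Qed.

Lemma clamp_id (a b X : R) : a <= X <= b -> clamp a b X = X.
Proof.
  intros [h1 h2]; unfold clamp.
  rewrite Rmin_right, Rmax_right; auto.
Qed.

Lemma clamp_lipschitz (a b X Y : R) :
  Rabs (clamp a b Y - clamp a b X) <= Rabs (Y - X).
Proof.
  unfold clamp, Rmax, Rmin; repeat destruct Rle_dec;
    unfold Rabs; repeat destruct Rcase_abs; lra.
Qed.

Lemma continuity_pt_clamp (a b : R) (f : R -> R) :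
  a <= b -> continuous_on (Icc a b) f ->
  forall X, continuity_pt (fun Y => f (clamp a b Y)) X.
Proof.
  intros hab hf X.
  apply continuity_pt_filterlim, filterlim_locally; intros eps.
  destruct (proj1 (filterlim_locally _ _) (hf _ (clamp_Icc a b X hab)) eps)
    as [d hd].
  exists d; intros Y hY.
  apply hd; [| now apply clamp_Icc].
  eapply Rle_lt_trans; [apply clamp_lipschitz | exact hY].
Qed.

(** Only space is clamped; time stays restricted to [0 < s]. Time is placed first, the argument
    order that [is_derive_RInt_param] expects for differentiation under the integral sign. *)
Lemma continuity_2d_pt_clamp (a b : R) (u : R -> R -> R) (s Y : R) :
  a <= b -> 0 < s -> jointly_continuous_on (cyl a b) u ->
  continuity_2d_pt (fun s Y => u (clamp a b Y) s) s Y.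
Proof.
  intros hab hs hu.
  apply continuity_2d_pt_filterlim, filterlim_locally; intros eps.
  destruct (proj1 (filterlim_locally _ _)
    (hu (clamp a b Y, s) (conj (clamp_Icc a b Y hab) hs)) eps) as [d hd].
  (* Capping the radius by [s] keeps every nearby time positive, hence inside the cylinder. *)
  exists (mkposreal _ (Rmin_pos _ _ (cond_pos d) hs)).
  intros [s' Y'] [h1 h2]; simpl in *.
  assert (h1' : Rabs (s' - s) < Rmin d s) by exact h1.
  assert (h2' : Rabs (Y' - Y) < Rmin d s) by exact h2.
  pose proof (Rmin_l d s); pose proof (Rmin_r d s).
  apply (hd (clamp a b Y', s')).
  - split; simpl.
    + eapply Rle_lt_trans; [apply clamp_lipschitz | lra].
    + change (Rabs (s' - s) < d); lra.
  - split; simpl; [now apply clamp_Icc |].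
    apply Rabs_def2 in h1'; lra.
Qed.

Lemma continuity_2d_pt_slice (f : R -> R -> R) (s Y : R) :
  continuity_2d_pt f s Y -> continuity_pt (f s) Y.
Proof.
  intros h; apply continuity_pt_filterlim, filterlim_locally; intros eps.
  destruct (h eps) as [d hd].
  exists d; intros Z hZ; apply hd; [| exact hZ].
  rewrite Rminus_eq_0, Rabs_R0; apply cond_pos.
Qed.

Lemma continuity_2d_pt_snd (f : R -> R) (s Y : R) :
  continuity_pt f Y -> continuity_2d_pt (fun _ Z => f Z) s Y.
Proof.
  intros h; apply (continuity_1d_2d_pt_comp f (fun _ Z => Z)); auto.
  apply continuity_2d_pt_id2.
Qed.

(** * Derivatives relative to the interval and ordinary derivatives *)

Lemma locally_open_interval (a b X : R) :
  a < X < b -> locally X (fun Y => a < Y < b).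
Proof.
  intros h; apply (open_and _ _ (open_gt a) (open_lt b)); exact h.
Qed.

(** An interior point has a whole neighbourhood inside the interval, so restricting the difference
    quotient to [Icc a b] changes nothing in the limit. *)
Lemma is_derive_on_interior (a b : R) (f : R -> R) (X l : R) :
  a < X < b -> (is_derive_on (Icc a b) f X l <-> is_derive f X l).
Proof.
  intros hX; rewrite is_derive_Reals; split.
  - intros h eps heps.
    destruct (proj1 (filterlim_locally _ _) h (mkposreal _ heps)) as [d hd].
    destruct (locally_open_interval a b X hX) as [d' hd'].
    exists (mkposreal _ (Rmin_pos _ _ (cond_pos d) (cond_pos d'))).
    intros k hk hkd; simpl in hkd.
    pose proof (Rmin_l d d'); pose proof (Rmin_r d d').
    assert (hb : forall e : posreal, Rmin d d' <= e -> ball X e (X + k)).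
    { intros e he; change (Rabs (X + k - X) < e).
      replace (X + k - X) with k by ring; lra. }
    assert (hin := hd' _ (hb d' ltac:(lra))).
    assert (hne : X + k <> X) by (intro; apply hk; lra).
    assert (hI : Icc a b (X + k)) by (unfold Icc; lra).
    specialize (hd _ (hb d ltac:(lra)) hne hI).
    replace k with (X + k - X) at 2 by ring.
    exact hd.
  - intros h; apply filterlim_locally; intros eps.
    destruct (h eps (cond_pos eps)) as [d hd].
    exists d; intros Y hY hne _.
    specialize (hd (Y - X) ltac:(lra) hY).
    rewrite Rplus_minus in hd.
    exact hd.
Qed.

Lemma ex_derive_on_interior (a b : R) (f : R -> R) (X : R) :
  a < X < b -> ex_derive_on (Icc a b) f X -> ex_derive f X.
Proof.
  intros hX [l hl]; exists l; now apply (is_derive_on_interior a b).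
Qed.

(** [iota] returns the unique solution, and at an interior point uniqueness is inherited from the
    two-sided derivative. *)
Lemma Derive_on_interior (a b : R) (f : R -> R) (X : R) :
  a < X < b -> ex_derive f X -> Derive_on (Icc a b) f X = Derive f X.
Proof.
  intros hX hf; unfold Derive_on.
  apply (@iota_unique R_AbsRing R_CompleteNormedModule).
  - intros l hl; symmetry; apply is_derive_unique.
    now apply (is_derive_on_interior a b).
  - apply is_derive_on_interior; [exact hX | now apply Derive_correct].
Qed.

(** Near [X] the difference quotient is bounded by [Rabs l + 1], which gives a Lipschitz estimate at
    [X]. The argument also covers the endpoints of an interval. *)
Lemma ex_derive_on_continuous (D : R -> Prop) (f : R -> R) :
  (forall X, D X -> ex_derive_on D f X) -> continuous_on D f.
Proof.
  intros h X hX; destruct (h X hX) as [l hl].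
  apply filterlim_locally; intros eps.
  destruct (proj1 (filterlim_locally _ _) hl (mkposreal 1 Rlt_0_1)) as [d hd].
  assert (hc : 0 < Rabs l + 1) by (pose proof (Rabs_pos l); lra).
  exists (mkposreal _ (Rmin_pos _ _ (cond_pos d)
    (Rdiv_lt_0_compat _ _ (cond_pos eps) hc))).
  intros Y hY hYD; change (Rabs (Y - X) < Rmin d (eps / (Rabs l + 1))) in hY.
  change (Rabs (f Y - f X) < eps).
  (* The punctured filter [locally'] says nothing at [Y = X], so that case is separate. *)
  destruct (Req_dec Y X) as [-> | hne].
  { rewrite Rminus_eq_0, Rabs_R0; apply cond_pos. }
  pose proof (Rmin_l d (eps / (Rabs l + 1))).
  pose proof (Rmin_r d (eps / (Rabs l + 1))).
  assert (hq : Rabs ((f Y - f X) / (Y - X) - l) < 1).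
  { apply (hd Y); auto; change (Rabs (Y - X) < d); lra. }
  assert (hq' : Rabs ((f Y - f X) / (Y - X)) <= Rabs l + 1).
  { replace ((f Y - f X) / (Y - X)) with
      (((f Y - f X) / (Y - X) - l) + l) by ring.
    eapply Rle_trans; [apply Rabs_triang | lra]. }
  replace (f Y - f X) with ((f Y - f X) / (Y - X) * (Y - X))
    by (field; lra).
  rewrite Rabs_mult.
  eapply Rle_lt_trans.
  { apply Rmult_le_compat_r; [apply Rabs_pos | exact hq']. }
  replace (pos eps) with ((Rabs l + 1) * (eps / (Rabs l + 1)))
    by (field; lra).
  apply Rmult_lt_compat_l; lra.
Qed.

(** * Fundamental theorem of calculus with an interior derivative *)

(** Differentiability is asked only on the open interval because the equation holds only there and
    clamped functions may have corners at the endpoints. The difference of [f] and the primitive of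
    [df] has derivative zero inside and is continuous up to the boundary, so the mean value theorem
    equates its two end values. *)
Lemma is_RInt_derive_interior (f df : R -> R) (a b : R) :
  a < b ->
  (forall X, a < X < b -> is_derive f X (df X)) ->
  (forall X, a <= X <= b -> continuity_pt f X) ->
  (forall X, continuity_pt df X) ->
  is_RInt df a b (f b - f a).
Proof.
  intros hab hd hf hdf.
  assert (hex : forall Y, ex_RInt df a Y).
  { intros Y; apply (@ex_RInt_continuous R_CompleteNormedModule); intros z _.
    now apply continuity_pt_filterlim. }
  assert (hG : forall Y, is_derive (fun Z => RInt df a Z) Y (df Y)).
  { intros Y; apply (is_derive_RInt df _ a).
    - apply filter_forall; intros Z; now apply (@RInt_correct R_CompleteNormedModule).
    - now apply continuity_pt_filterlim. }
  destruct (MVT_gen (fun Y => f Y - RInt df a Y) a b (fun _ => 0))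
    as [c [_ hc]].
  - rewrite Rmin_left, Rmax_right by lra; intros Y hY.
    replace 0 with (df Y - df Y) by ring.
    exact (is_derive_minus _ _ _ _ _ (hd Y hY) (hG Y)).
  - rewrite Rmin_left, Rmax_right by lra; intros Y hY.
    apply continuity_pt_minus; [now apply hf |].
    apply continuity_pt_filterlim, @ex_derive_continuous.
    eexists; apply hG.
  - rewrite RInt_point in hc.
    replace (f b - f a) with (RInt df a b).
    + now apply (@RInt_correct R_CompleteNormedModule).
    + change (@zero R_CompleteNormedModule) with 0 in hc.
      lra.
Qed.

(** * Differential identities for the flow map and the energy density *)

(** This is [v_X = p_t]. Schwarz's theorem applies at interior points, where both mixed derivatives
    are ordinary ones and jointly continuous; most of the work turns relative derivatives into
    ordinary ones on a neighbourhood. *)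
Lemma mixed_partials_cyl (a b : R) (x : R -> R -> R) (X t : R) :
  C2_cyl a b x -> a < X < b -> 0 < t ->
  is_derive (fun Y => dt x Y t) X (dt (dX a b x) X t).
Proof.
  intros [[hex _] [[hexX [_ hcXt]] [hext [hctX _]]]] hX ht.
  assert (hab : a <= b) by lra.
  assert (hIcc : forall Y, a < Y < b -> a <= Y <= b) by (intros; lra).
  assert (hdX : forall Y s, a < Y < b -> 0 < s ->
    Derive (fun Z => x Z s) Y = dX a b x Y s).
  { intros Y s hY hs; symmetry; apply Derive_on_interior; [exact hY |].
    apply (ex_derive_on_interior a b); [exact hY | now apply hex; auto]. }
  assert (hloc : forall Y s, a < Y < b -> 0 < s ->
    locally s (fun r => Derive (fun Z => x Z r) Y = dX a b x Y r)).
  { intros Y s hY hs.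
    apply (filter_imp (fun r => 0 < r)); [intros; now apply hdX |].
    now apply open_gt. }
  assert (hdXt : forall Y s, a < Y < b -> 0 < s ->
    Derive (fun r => Derive (fun Z => x Z r) Y) s = dt (dX a b x) Y s).
  { intros Y s hY hs; apply Derive_ext_loc; auto. }
  assert (hV : forall Y s, a < Y < b -> 0 < s ->
    ex_derive (fun Z => dt x Z s) Y).
  { intros Y s hY hs; apply (ex_derive_on_interior a b); [exact hY |].
    now apply hext; auto. }
  assert (hnear : locally_2d (fun Y s => a < Y < b /\ 0 < s) X t).
  { destruct (locally_open_interval a b X hX) as [d hd].
    destruct (open_gt 0 t ht) as [d' hd'].
    exists (mkposreal _ (Rmin_pos _ _ (cond_pos d) (cond_pos d'))).
    simpl; intros Y s hY hs.
    pose proof (Rmin_l d d'); pose proof (Rmin_r d d').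
    split; [apply hd | apply hd'].
    - change (Rabs (Y - X) < d); lra.
    - change (Rabs (s - t) < d'); lra. }
  (* Near an interior point the clamp is the identity, so the continuity of the clamped function,
     with its arguments swapped, is that of [u]. *)
  assert (hcont : forall u, jointly_continuous_on (cyl a b) u ->
    continuity_2d_pt u X t).
  { intros u hu eps.
    assert (hc := continuity_2d_pt_clamp a b u t X hab ht hu eps).
    destruct hc as [d hd].
    destruct hnear as [d' hd'].
    exists (mkposreal _ (Rmin_pos _ _ (cond_pos d) (cond_pos d'))).
    simpl; intros Y s hY hs.
    pose proof (Rmin_l d d'); pose proof (Rmin_r d d').
    specialize (hd s Y ltac:(lra) ltac:(lra)).
    destruct (hd' Y s ltac:(lra) ltac:(lra)) as [hin _].
    rewrite !clamp_id in hd by lra; exact hd. }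
  rewrite <- hdXt by assumption.
  rewrite <- (Schwarz x X t).
  - apply Derive_correct, hV; assumption.
  - apply (fun h => locally_2d_impl _ _ X t h hnear).
    apply locally_2d_forall; intros Y s [hY hs].
    destruct (hex Y s (hIcc _ hY) hs) as [h1 h2].
    destruct (hexX Y s (hIcc _ hY) hs) as [_ h3].
    repeat split.
    + now apply (ex_derive_on_interior a b).
    + exact h2.
    + now apply hV.
    + apply (ex_derive_ext_loc (dX a b x Y)); [| exact h3].
      apply (filter_imp (fun r => Derive (fun Z => x Z r) Y = dX a b x Y r));
        [intros r hr; now symmetry | now apply hloc].
  - apply (continuity_2d_pt_ext_loc (dX a b (dt x))); [| now apply hcont].
    apply (fun h => locally_2d_impl _ _ X t h hnear).
    apply locally_2d_forall; intros Y s [hY hs].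
    apply Derive_on_interior; [exact hY | now apply hV].
  - apply (continuity_2d_pt_ext_loc (dt (dX a b x))); [| now apply hcont].
    apply (fun h => locally_2d_impl _ _ X t h hnear).
    apply locally_2d_forall; intros Y s [hY hs].
    symmetry; now apply hdXt.
Qed.

(** A positive time has a neighbourhood of positive times, on which the boundary point does not
    move. *)
Lemma dt_boundary (x : R -> R -> R) (X t : R) :
  0 < t -> (forall s, 0 < s -> x X s = X) -> dt x X t = 0.
Proof.
  intros ht hx; unfold dt.
  rewrite (Derive_ext_loc _ (fun _ => X)).
  - apply Derive_const.
  - apply (filter_imp (fun s => 0 < s)); [exact hx | now apply open_gt].
Qed.

(** With [r = f0' / p], the chain rule gives [- r r' + F'(f0) f0'] for the derivative, which is
    [f0'] times the right-hand side of the equation. *)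
Lemma is_derive_energy_density (a b : R) (f0 F : R -> R) (p : R -> R)
  (X v : R) :
  a < X < b -> C2_on (Icc a b) f0 -> ex_derive F (f0 X) ->
  ex_derive_on (Icc a b) p X -> 0 < p X ->
  v * Derive_on (Icc a b) f0 X * / p X =
    - Derive_on (Icc a b) (fun Y => Derive_on (Icc a b) f0 Y * / p Y) X * / p X
    + Derive F (f0 X) ->
  is_derive
    (fun Y => - (1 / 2) * (Derive_on (Icc a b) f0 Y * / p Y) ^ 2 + F (f0 Y))
    X (v * Derive_on (Icc a b) f0 X ^ 2 * / p X).
Proof.
  intros hX [[hf _] [hg _]] hF hp hp0 heq.
  assert (hI : Icc a b X) by (unfold Icc; lra).
  assert (hf' := ex_derive_on_interior _ _ _ _ hX (hf _ hI)).
  assert (hg' := ex_derive_on_interior _ _ _ _ hX (hg _ hI)).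
  assert (hp' := ex_derive_on_interior _ _ _ _ hX hp).
  assert (hf0' := Derive_on_interior _ _ _ _ hX hf').
  set (g := Derive_on (Icc a b) f0) in *.
  set (r := fun Y : R => g Y * / p Y) in *.
  assert (hr : ex_derive r X).
  { apply (ex_derive_mult g (fun Y => / p Y)); [exact hg' |].
    apply ex_derive_inv; [exact hp' | lra]. }
  rewrite (Derive_on_interior _ _ _ _ hX hr) in heq.
  (* Factoring out [g X] exposes the left-hand side of the equation. *)
  replace (v * g X ^ 2 * / p X) with (g X * (v * g X * / p X)) by ring.
  rewrite heq.
  replace (g X * (- Derive r X * / p X + Derive F (f0 X)))
    with (- (r X * Derive r X) + Derive F (f0 X) * g X) by (unfold r; ring).
  rewrite hf0'.
  change (is_derive (fun Y => - (1 / 2) * (r Y) ^ 2 + F (f0 Y)) X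
    (- (r X * Derive r X) + Derive F (f0 X) * Derive f0 X)).
  auto_derive; [tauto |].
  change (fun Y => r Y) with r; change (fun Y => F Y) with F.
  change (fun Y => f0 Y) with f0; field.
Qed.

(** * The energy dissipation law *)

Theorem theorem2p1
  (a b : R) (hab : a < b)
  (f0 : R -> R) (hf0 : C2_on (Icc a b) f0)
  (F : R -> R) (hF : C1_R F)
  (x : R -> R -> R)
  (hx_cont : jointly_continuous_on (cyl0 a b) x)
  (hx_C2 : C2_cyl a b x)
  (hx_pos : forall X t, a <= X <= b -> 0 < t -> 0 < dX a b x X t)
  (hx_eq : forall X t, a < X < b -> 0 < t ->
     dt x X t * Derive_on (Icc a b) f0 X * / dX a b x X t =
     - Derive_on (Icc a b)
         (fun Y => Derive_on (Icc a b) f0 Y * / dX a b x Y t) X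
       * / dX a b x X t
     + Derive F (f0 X))
  (hx_bdry : forall X t, X = a \/ X = b -> 0 < t -> x X t = X)
  (hx_init : forall X, a < X < b -> x X 0 = X) :
  forall t, 0 < t ->
    ex_RInt (fun X =>
      dX a b x X t *
      (1 / 2 * Rabs (Derive_on (Icc a b) f0 X * / dX a b x X t) ^ 2
       + F (f0 X))) a b /\
    ex_RInt (fun X =>
      dX a b x X t *
      Rabs (dt x X t * Derive_on (Icc a b) f0 X * / dX a b x X t) ^ 2) a b /\
    is_derive (fun s => RInt (fun X =>
      dX a b x X s *
      (1 / 2 * Rabs (Derive_on (Icc a b) f0 X * / dX a b x X s) ^ 2
       + F (f0 X))) a b) t
    (- RInt (fun X =>
      dX a b x X t *
      Rabs (dt x X t * Derive_on (Icc a b) f0 X * / dX a b x X t) ^ 2) a b).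
Proof.
  intros t ht.
  assert (hle : a <= b) by lra.
  pose proof hx_C2 as [[_ [hcX hct]] [[hexX [_ hcXt]] _]].
  (* Clamped versions, continuous in [Y] on all of R: [f], [G], [P], [V], [Q] stand for [f0], [f0'],
     [p], [v], [p_t]. [E] is the energy density, [H] the function [h], and [W] the dissipation
     density. *)
  set (c := clamp a b).
  set (g := Derive_on (Icc a b) f0).
  set (f := fun Y => f0 (c Y)).
  set (G := fun Y => g (c Y)).
  set (P := fun s Y => dX a b x (c Y) s).
  set (V := fun s Y => dt x (c Y) s).
  set (Q := fun s Y => dt (dX a b x) (c Y) s).
  set (E := fun s Y => P s Y * (1 / 2 * (G Y * / P s Y) ^ 2 + F (f Y))).
  set (H := fun s Y => - (1 / 2) * (G Y * / P s Y) ^ 2 + F (f Y)).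
  set (W := fun s Y => P s Y * (V s Y * G Y * / P s Y) ^ 2).
  assert (hP : forall s Y, 0 < s -> continuity_2d_pt P s Y)
    by (intros; now apply continuity_2d_pt_clamp).
  assert (hV : forall s Y, 0 < s -> continuity_2d_pt V s Y)
    by (intros; now apply continuity_2d_pt_clamp).
  assert (hQ : forall s Y, 0 < s -> continuity_2d_pt Q s Y)
    by (intros; now apply continuity_2d_pt_clamp).
  assert (hP0 : forall s Y, 0 < s -> 0 < P s Y).
  { intros s Y hs; apply hx_pos; [now apply clamp_Icc | exact hs]. }
  assert (hG : forall s Y, continuity_2d_pt (fun _ Z => G Z) s Y).
  { intros s Y; apply continuity_2d_pt_snd, continuity_pt_clamp; [exact hle |].
    apply hf0. }
  assert (hFf : forall s Y, continuity_2d_pt (fun _ Z => F (f Z)) s Y).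
  { intros s Y; apply continuity_2d_pt_snd.
    apply (continuity_pt_comp f F).
    - apply continuity_pt_clamp; [exact hle |].
      apply ex_derive_on_continuous, hf0.
    - apply continuity_pt_filterlim, @ex_derive_continuous, hF. }
  assert (hr : forall s Y, 0 < s ->
    continuity_2d_pt (fun s Y => G Y * / P s Y) s Y).
  { intros s Y hs; apply continuity_2d_pt_mult; [apply hG |].
    apply continuity_2d_pt_inv; [now apply hP |].
    apply Rgt_not_eq; now apply hP0. }
  assert (hsq : forall u s Y, continuity_2d_pt u s Y ->
    continuity_2d_pt (fun s Y => u s Y ^ 2) s Y).
  { intros u s Y hu.
    apply (continuity_2d_pt_ext (fun s Y => u s Y * u s Y)).
    - intros; ring.
    - now apply continuity_2d_pt_mult. }
  assert (hE : forall s Y, 0 < s -> continuity_2d_pt E s Y).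
  { intros s Y hs; apply continuity_2d_pt_mult; [now apply hP |].
    apply continuity_2d_pt_plus; [| apply hFf].
    apply continuity_2d_pt_mult; [apply continuity_2d_pt_const |].
    now apply hsq, hr. }
  assert (hH : forall s Y, 0 < s -> continuity_2d_pt H s Y).
  { intros s Y hs.
    apply continuity_2d_pt_plus; [| apply hFf].
    apply continuity_2d_pt_mult; [apply continuity_2d_pt_const |].
    now apply hsq, hr. }
  assert (hW : forall s Y, 0 < s -> continuity_2d_pt W s Y).
  { intros s Y hs; apply continuity_2d_pt_mult; [now apply hP |].
    apply hsq.
    apply (continuity_2d_pt_ext (fun s Y => V s Y * (G Y * / P s Y))).
    - intros; ring.
    - apply continuity_2d_pt_mult; [now apply hV | now apply hr]. }
  assert (hQH : forall s Y, 0 < s ->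
    continuity_2d_pt (fun s Y => Q s Y * H s Y) s Y).
  { intros s Y hs; apply continuity_2d_pt_mult; auto. }
  assert (hint : forall u, (forall s Y, 0 < s -> continuity_2d_pt u s Y) ->
    forall s, 0 < s -> ex_RInt (u s) a b).
  { intros u hu s hs; apply (@ex_RInt_continuous R_CompleteNormedModule); intros Y _.
    apply continuity_pt_filterlim, continuity_2d_pt_slice; auto. }
  (* Equality on the open interval suffices for the integrals to agree; there the clamp is the
     identity and the absolute value is absorbed by the square. *)
  assert (hEeq : forall s Y, Rmin a b < Y < Rmax a b ->
    E s Y = dX a b x Y s * (1 / 2 * Rabs (g Y * / dX a b x Y s) ^ 2 + F (f0 Y))).
  { rewrite Rmin_left, Rmax_right by lra; intros s Y hY.
    unfold E, P, G, f, c; rewrite clamp_id, pow2_abs by lra; reflexivity. }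
  assert (hWeq : forall s Y, Rmin a b < Y < Rmax a b ->
    W s Y = dX a b x Y s * Rabs (dt x Y s * g Y * / dX a b x Y s) ^ 2).
  { rewrite Rmin_left, Rmax_right by lra; intros s Y hY.
    unfold W, P, V, G, c; rewrite clamp_id, pow2_abs by lra; reflexivity. }
  (* As a function of [p], the energy density is [f0'^2 / (2 p) + p F(f0)], whose derivative in [p]
     is exactly [h]. Hence [E_t = p_t h]. *)
  assert (hEd : forall s Y, 0 < s ->
    is_derive (fun r => E r Y) s (Q s Y * H s Y)).
  { intros s Y hs.
    assert (hd : ex_derive (fun r => P r Y) s)
      by (apply hexX; [now apply clamp_Icc | exact hs]).
    assert (h0 := hP0 s Y hs).
    unfold E; auto_derive.
    - repeat split; auto; lra.
    - change (Derive (fun r => P r Y) s) with (Q s Y).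
      unfold H; field; lra. }
  (* Product rule for the flux [v h]: [v_X h = p_t h] by the mixed partials, and
     [v h_X = v^2 f0'^2 / p] is the dissipation density. *)
  assert (hfluxd : forall Y, a < Y < b ->
    is_derive (fun Z => V t Z * H t Z) Y (Q t Y * H t Y + W t Y)).
  { intros Y hY.
    assert (hl : locally Y (fun Z => c Z = Z)).
    { apply (filter_imp (fun Z => a < Z < b));
        [intros; apply clamp_id; lra | now apply locally_open_interval]. }
    assert (hcY : c Y = Y) by (apply clamp_id; lra).
    assert (hYI : a <= Y <= b) by lra.
    assert (h0 := hx_pos Y t hYI ht).
    apply (is_derive_ext_loc (fun Z => dt x Z t *
      (- (1 / 2) * (g Z * / dX a b x Z t) ^ 2 + F (f0 Z)))).
    { apply filter_imp with (2 := hl); intros Z hZ.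
      unfold V, H, G, P, f; now rewrite hZ. }
    assert (h1 := mixed_partials_cyl a b x Y t hx_C2 hY ht).
    assert (h2 : is_derive
      (fun Z => - (1 / 2) * (g Z * / dX a b x Z t) ^ 2 + F (f0 Z)) Y
      (dt x Y t * g Y ^ 2 * / dX a b x Y t)).
    { apply (is_derive_energy_density a b f0 F (fun Z => dX a b x Z t));
        auto; [apply hF | now apply hexX]. }
    replace (Q t Y * H t Y + W t Y) with
      (dt (dX a b x) Y t *
         (- (1 / 2) * (g Y * / dX a b x Y t) ^ 2 + F (f0 Y)) +
       dt x Y t * (dt x Y t * g Y ^ 2 * / dX a b x Y t)).
    - apply (is_derive_mult (fun Z => dt x Z t) _ _ _ _ h1 h2), Rmult_comm.
    - unfold Q, H, W, V, P, G, f; rewrite hcY; field; lra. }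
  (* The flux vanishes at both endpoints since [v] does, so its derivative integrates to zero. This
     is the integration by parts. *)
  assert (hflux : is_RInt (fun Y => Q t Y * H t Y + W t Y) a b 0).
  { replace 0 with (V t b * H t b - V t a * H t a).
    - apply (is_RInt_derive_interior (fun Z => V t Z * H t Z)); auto.
      + intros Y _; apply (continuity_2d_pt_slice (fun s Z => V s Z * H s Z)).
        apply continuity_2d_pt_mult; auto.
      + intros Y; apply (continuity_2d_pt_slice
          (fun s Z => Q s Z * H s Z + W s Z)).
        apply continuity_2d_pt_plus; auto.
    - unfold V, c; rewrite !clamp_id by lra.
      rewrite !dt_boundary by auto; ring. }
  assert (hWint := hint W hW t ht).
  assert (hQHint : RInt (fun Y => Q t Y * H t Y) a b = - RInt (W t) a b).
  { apply is_RInt_unique.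
    replace (- RInt (W t) a b) with (minus 0 (RInt (W t) a b))
      by (unfold minus, plus, opp; simpl; ring).
    apply (is_RInt_ext (fun Y => minus (Q t Y * H t Y + W t Y) (W t Y))).
    - intros Y _; unfold minus, plus, opp; simpl; ring.
    - apply @is_RInt_minus; [exact hflux | now apply (@RInt_correct R_CompleteNormedModule)]. }
  split; [| split].
  - apply (ex_RInt_ext (E t)); [apply hEeq | now apply hint].
  - apply (ex_RInt_ext (W t)); [apply hWeq | exact hWint].
  - rewrite <- (RInt_ext _ _ a b (hWeq t)), <- hQHint.
    apply (is_derive_ext (fun s => RInt (E s) a b)).
    { intros s; apply RInt_ext, hEeq. }
    (* The integrand is put back as a time derivative of [E], the form in which
       [is_derive_RInt_param] states its conclusion. *)
    rewrite <- (RInt_ext (fun Y => Derive (fun r => E r Y) t)).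
    2: { intros Y _; now apply is_derive_unique, hEd. }
    apply (is_derive_RInt_param E a b t).
    + apply (filter_imp (fun s => 0 < s)); [| now apply open_gt].
      intros s hs Y _; eexists; now apply hEd.
    + intros Y _.
      apply (continuity_2d_pt_ext_loc (fun s Z => Q s Z * H s Z)); auto.
      (* Radius [t] keeps [s] positive, where the formula for [E_t] is available. *)
      exists (mkposreal t ht); simpl; intros s Z hs _.
      symmetry; apply is_derive_unique, hEd.
      apply Rabs_def2 in hs; lra.
    + apply (filter_imp (fun s => 0 < s)); [| now apply open_gt].
      intros s hs; now apply hint.
Qed.
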